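(* There exists a two-sided adaptive tester for $2$-monotonicity of functions $f\colon[n]^2\to\{0,1\}$ with query complexity $q(n,\varepsilon)=O(1/\varepsilon)$.
   Context: $[n]^2$ is ordered coordinatewise: $(i,j)\preceq(i',j')$ iff $i\leq i'$ and $j\leq j'$. A function $f\colon[n]^2\to\{0,1\}$ is $2$-monotone if there do not exist $x_1\preceq x_2\preceq x_3$ with $f(x_1)=1,f(x_2)=0,f(x_3)=1$. Distance is normalized Hamming distance. A tester, given $\varepsilon$ and query access to $f$, accepts $2$-monotone $f$ with probability at least $2/3$ and rejects $f$ that is $\varepsilon$-far from $2$-monotone with probability at least $2/3$; it may err on both sides and its queries may depend on previous answers. *)

(* Defs.v *)
From mathcomp Require Import all_boot.
From Stdlib Require Import Reals.
Set Implicit Arguments. Unset Strict Implicit. Unset Printing Implicit Defensive.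

Definition point (n : nat) := ('I_n * 'I_n)%type.

Definition ple (n : nat) (x y : point n) : bool :=
  ((nat_of_ord x.1 <= nat_of_ord y.1) && (nat_of_ord x.2 <= nat_of_ord y.2))%N.

Definition two_monotone (n : nat) (f : point n -> bool) : Prop :=
  ~ exists x1 x2 x3 : point n,
      [/\ ple x1 x2, ple x2 x3, f x1 = true, f x2 = false & f x3 = true].

Definition hamming (n : nat) (f g : point n -> bool) : nat :=
  #|[pred x : point n | f x != g x]|.

Definition eps_far (n : nat) (eps : R) (f : point n -> bool) : Prop :=
  forall g : point n -> bool, two_monotone g ->
    (eps <= INR (hamming f g) / INR (n * n))%R.

(* Deterministic adaptive query algorithm = decision tree: internal nodes
   query f at a point and branch on the answer; leaves output accept/reject. *)
Inductive dtree (n : nat) : Type :=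
| Leaf : bool -> dtree n
| Query : point n -> dtree n -> dtree n -> dtree n.

Fixpoint run (n : nat) (t : dtree n) (f : point n -> bool) : bool :=
  match t with
  | Leaf b => b
  | Query x t0 t1 => if f x then run t1 f else run t0 f
  end.

Fixpoint depth (n : nat) (t : dtree n) : nat :=
  match t with
  | Leaf _ => 0
  | Query _ t0 t1 => (maxn (depth t0) (depth t1)).+1
  end.

(* Randomized adaptive algorithm = probability distribution over decision
   trees, given as a finite list of (probability, tree) pairs. *)
Definition rtester (n : nat) := list (R * dtree n).

Definition is_distribution (n : nat) (T : rtester n) : Prop :=
  List.Forall (fun p => (0 <= fst p)%R) T /\
  List.fold_right (fun p acc => (fst p + acc)%R) 0%R T = 1%R.

Definition accept_prob (n : nat) (T : rtester n) (f : point n -> bool) : R :=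
  List.fold_right (fun p acc => ((if run (snd p) f then fst p else 0) + acc)%R) 0%R T.

Definition query_bound (n : nat) (T : rtester n) (q : R) : Prop :=
  List.Forall (fun p => (INR (depth (snd p)) <= q)%R) T.

(* Main.v *)
(** The ones of a 2-monotone f form an order-convex set. Cut the grid into
blocks, m in each direction with m = O(1/eps), and look at f at one corner of
every block only: f alternates at most twice along a chain, so a diagonal of
blocks contains few points that disagree with the corner of their block.

Once some ones, the seeds, are known, f is monotone below them and antitone
above them, so two staircase searches with O(m) queries determine f at all
blocks comparable to a seed. To find seeds, start at the upper left cell and
query one random cell of the hook of radius r = 0, 1, 2, ... around the current
cell; when a one is found it becomes a seed and the search restarts from it.
A hook is a chain, so a seed on it is comparable to all its cells, and only ones
on hooks sampled in vain can be missed. A hook of radius r has 2r + 1 cells,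
hence if it contains a ones the expected number missed is at most
a = (2r + 1) P(hit), while a hit advances the search by more than r; the total
expected number of missed ones is therefore O(m), with O(m) queries.

The order-convex hull H of the learned ones is 2-monotone whatever f is, so
comparing f and H on about 2/eps random points rejects every eps-far f with
probability at least 2/3, and for 2-monotone f the expected distance of f and H
is a small multiple of eps. When n is too small for blocks, each hook is sampled
several times instead. *)
Require Import Defs.
From mathcomp Require Import all_boot.
From mathcomp Require Import all_order all_algebra.
From Stdlib Require Import Reals Lra.
From mathcomp Require Import ring lra zify Rstruct.
Delimit Scope nat_scope with N.
Set Implicit Arguments.
Unset Strict Implicit.
Unset Printing Implicit Defensive.

(** * Randomized query programs *)

Section Programs.
Import Order.TTheory GRing.Theory Num.Theory.
Local Open Scope ring_scope.

(** A free monad of adaptive randomized computations; [Flip N] chooses uniformly among the [N.+1]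
    values up to [N], so the choice is never empty. *)
Inductive prog (Q A : Type) :=
| Ret of A
| Ask of Q & (bool -> prog Q A)
| Flip of nat & (nat -> prog Q A).

Fixpoint bind (Q A B : Type) (p : prog Q A) (k : A -> prog Q B) : prog Q B :=
  match p with
  | Ret a => k a
  | Ask q g => Ask q (fun v => bind (g v) k)
  | Flip N g => Flip N (fun i => bind (g i) k)
  end.

Definition draw (Q A : Type) (d : A) (s : seq A) : prog Q A :=
  Flip (size s).-1 (fun i => Ret Q (nth d s i)).

Fixpoint expect (R : realFieldType) (Q A : Type) (O : Q -> bool)
    (p : prog Q A) (phi : A -> R) : R :=
  match p with
  | Ret a => phi a
  | Ask q g => expect O (g (O q)) phi
  | Flip N g => N.+1%:R^-1 * \sum_(i < N.+1) expect O (g i) phi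
  end.

Fixpoint always (Q A : Type) (O : Q -> bool) (p : prog Q A) (P : A -> Prop) :=
  match p with
  | Ret a => P a
  | Ask q g => always O (g (O q)) P
  | Flip N g => forall i, (i <= N)%N -> always O (g i) P
  end.

(** Both answers are followed, unlike in [always], because the depth of a decision tree does not
    depend on the oracle. *)
Fixpoint queries_le (Q A : Type) (p : prog Q A) (b : nat) : Prop :=
  match p with
  | Ret _ => True
  | Ask _ g => (0 < b)%N /\ forall v, queries_le (g v) b.-1
  | Flip _ g => forall i, queries_le (g i) b
  end.

Section Theory.
Variables (R : realFieldType) (Q : Type) (O : Q -> bool).

Lemma expect_bind A B (p : prog Q A) (k : A -> prog Q B) (phi : B -> R) :
  expect O (bind p k) phi = expect O p (fun a => expect O (k a) phi).
Proof.
elim: p => //= N g IH; congr (_ * _).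
by apply: eq_bigr => i _; exact: IH.
Qed.

Lemma le_expect A (p : prog Q A) (P : A -> Prop) (phi psi : A -> R) :
  always O p P -> (forall a, P a -> phi a <= psi a) ->
  expect O p phi <= expect O p psi.
Proof.
move=> + le; elim: p => /= [a Pa|q g IH al|N g IH al].
- exact: le.
- exact: IH.
rewrite ler_wpM2l ?invr_ge0 ?ler0n //; apply: ler_sum => i _.
by apply: IH; apply: al; rewrite -ltnS.
Qed.

Lemma alwaysT A (p : prog Q A) : always O p (fun=> True).
Proof. by elim: p => /=. Qed.

Lemma always_impl A (p : prog Q A) (P P' : A -> Prop) :
  (forall a, P a -> P' a) -> always O p P -> always O p P'.
Proof.
move=> i; elim: p => /= [a|q g IH al|N g IH al j jN].
- exact: i.
- exact: IH.
exact/IH/al.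
Qed.

Lemma always_bind A B (p : prog Q A) (k : A -> prog Q B) P P' :
  always O p P -> (forall a, P a -> always O (k a) P') ->
  always O (bind p k) P'.
Proof.
move=> + i; elim: p => /= [a|q g IH al|N g IH al j jN].
- exact: i.
- exact: IH.
exact/IH/al.
Qed.

Lemma expect_cst A (p : prog Q A) (r : R) : expect O p (fun=> r) = r.
Proof.
elim: p => //= N g IH.
rewrite (eq_bigr (fun=> r)) => [|i _]; last exact: IH.
by rewrite sumr_const card_ord -[r *+ _]mulr_natl mulKf // pnatr_eq0.
Qed.

Lemma expectZD A (p : prog Q A) (phi : A -> R) (r s : R) :
  expect O p (fun a => r + s * phi a) = r + s * expect O p phi.
Proof.
elim: p => //= N g IH.
under eq_bigr => i _ do rewrite IH.
rewrite big_split /= sumr_const card_ord -mulr_sumr mulrDr.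
by rewrite -[r *+ _]mulr_natl mulKf ?pnatr_eq0 // mulrCA.
Qed.

Lemma expect_draw A B (d : A) (s : seq A) (k : A -> prog Q B) (phi : B -> R) :
  (0 < size s)%N ->
  expect O (bind (draw Q d s) k) phi =
  (size s)%:R^-1 * \sum_(x <- s) expect O (k x) phi.
Proof. by move=> s0; rewrite /draw /= prednK // (big_nth d) big_mkord. Qed.

Lemma queries_le_mono A (p : prog Q A) a b :
  (a <= b)%N -> queries_le p a -> queries_le p b.
Proof.
elim: p a b => //= [q g IH a b ab [a0 ga]|N g IH a b ab ga i].
  split; first exact: leq_trans ab.
  by move=> v; apply: IH (ga v); lia.
exact: IH (ga i).
Qed.

Lemma queries_le_bind A B (p : prog Q A) (k : A -> prog Q B) a b :
  queries_le p a -> (forall x, queries_le (k x) b) ->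
  queries_le (bind p k) (a + b)%N.
Proof.
move=> + kb; elim: p a => //= [x a _|q g IH a [a0 ga]|N g IH a ga i].
- by apply: queries_le_mono (kb x); lia.
- split=> [|v]; first lia.
  by have := IH v _ (ga v); congr queries_le; lia.
- exact: IH.
Qed.

End Theory.
End Programs.

Lemma all_flatten (A : Type) (P : pred A) (ss : seq (seq A)) :
  all P (flatten ss) = all (all P) ss.
Proof. by elim: ss => //= s ss IH; rewrite all_cat IH. Qed.

(** * Programs as distributions over decision trees *)

Section Compile.
Import Order.TTheory GRing.Theory Num.Theory.
Local Open Scope ring_scope.
Variable n : nat.

Fixpoint compile (p : prog (point n) bool) : rtester n :=
  match p with
  | Ret b => [:: (1, Leaf n b)]
  | Ask q g => [seq (a.1 * b.1, Query q a.2 b.2)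
                 | a <- compile (g false), b <- compile (g true)]
  | Flip N g => flatten
      [seq [seq (N.+1%:R^-1 * a.1, a.2) | a <- compile (g (nat_of_ord i))]
       | i <- enum 'I_N.+1]
  end.

Lemma accept_probE (T : rtester n) f :
  accept_prob T f = \sum_(a <- T) if run a.2 f then a.1 else 0.
Proof. by elim: T => [|a T IH]; rewrite ?big_nil // big_cons -IH. Qed.

Lemma weightE (T : rtester n) :
  List.fold_right (fun p acc => (fst p + acc)%R) 0%R T = \sum_(a <- T) a.1.
Proof. by elim: T => [|a T IH]; rewrite ?big_nil // big_cons -IH. Qed.

Lemma compile_weight p : \sum_(a <- compile p) a.1 = 1 :> R.
Proof.
elim: p => [b|q g IH|N g IH] /=; first by rewrite big_seq1.
- rewrite big_allpairs_dep /=.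
  under eq_bigr => a _ do rewrite -mulr_sumr IH mulr1.
  exact: IH.
- rewrite big_flatten big_map /=.
  under eq_bigr => i _ do rewrite big_map -mulr_sumr IH mulr1.
  rewrite big_enum sumr_const card_ord.
  by rewrite -[X in X = _]mulr_natl mulfV // pnatr_eq0.
Qed.

(** At an [Ask] the trees for the two answers are chosen independently; a run follows one of them,
    and the weights of the other sum to one. *)
Lemma compile_accept p f :
  accept_prob (compile p) f = expect f p (fun b => b%:R).
Proof.
rewrite accept_probE; elim: p => [b|q g IH|N g IH] /=.
- by rewrite big_seq1; case: b.
- rewrite big_allpairs_dep /= -IH; case: (f q).
    rewrite exchange_big /=; apply: eq_bigr => b _.
    case: (run b.2 f); last by rewrite big1.
    by rewrite -mulr_suml compile_weight mul1r.
  apply: eq_bigr => a _.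
  case: (run a.2 f); last by rewrite big1.
  by rewrite -mulr_sumr compile_weight mulr1.
- rewrite big_flatten big_map mulr_sumr big_enum /=.
  apply: eq_bigr => i _; rewrite big_map -IH mulr_sumr.
  by apply: eq_bigr => a _ /=; case: ifP; rewrite ?mulr0.
Qed.

Lemma compile_ge0 p : List.Forall (fun a => (0 <= fst a)%R) (compile p).
Proof.
suff H : all (fun a => 0 <= a.1) (compile p).
  by elim: (compile p) H => //= a T IH /andP[a0 /IH]; constructor => //; apply/RleP.
elim: p => [b|q g IH|N g IH] /=; first by rewrite ler01.
- rewrite all_flatten all_map; apply: sub_all (IH false) => a a0 /=.
  rewrite all_map; apply: sub_all (IH true) => b b0 /=.
  exact: mulr_ge0.
- rewrite all_flatten all_map; apply/allP=> i _ /=.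
  rewrite all_map; apply: sub_all (IH i) => a a0 /=.
  by rewrite mulr_ge0 ?invr_ge0 ?ler0n.
Qed.

Lemma compile_depth p b :
  queries_le p b -> all (fun a => depth a.2 <= b)%N (compile p).
Proof.
elim: p b => [a|q g IH|N g IH] b //=.
- case=> b0 gb; rewrite all_flatten all_map.
  apply: sub_all (IH _ _ (gb false)) => c cb /=.
  rewrite all_map; apply: sub_all (IH _ _ (gb true)) => d db /=.
  by rewrite -(prednK b0) ltnS geq_max cb db.
- move=> gb; rewrite all_flatten all_map; apply/allP=> i _ /=.
  by rewrite all_map; apply: sub_all (IH _ _ (gb i)).
Qed.

End Compile.

(** * Searching for seeds *)

Notation cell := (nat * nat)%type.

(** The second coordinate is reversed because cells count block rows from the top: this is the order
    of blocks induced by [ple]. *)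
Definition cle (p q : cell) : bool := (p.1 <= q.1) && (q.2 <= p.2).

Definition ccomparable (p q : cell) : bool := cle p q || cle q p.

Definition in_grid (m : nat) (q : cell) : bool := (q.1 < m) && (q.2 < m).

Definition grid (m : nat) : seq cell := [seq (X, Z) | X <- iota 0 m, Z <- iota 0 m].

(** Cells at sup-distance exactly [r] from [(x, z)] in the quadrant beyond it, along row [z + r] and
    back along column [x + r]: a chain for [cle]. *)
Definition hook (x z r : nat) : seq cell :=
  [seq (x + k, z + r) | k <- iota 0 r.+1] ++ [seq (x + r, z + k) | k <- iota 0 r].

Lemma mem_grid m q : (q \in grid m) = in_grid m q.
Proof.
case: q => X Z; rewrite /in_grid.
apply/allpairsP/andP => [[[a b] /= []]|/= [Xm Zm]].
  by rewrite !mem_iota => am bm [-> ->]; lia.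
by exists (X, Z); rewrite !mem_iota; split => //; lia.
Qed.

Lemma grid_uniq m : uniq (grid m).
Proof. by apply: allpairs_uniq; rewrite ?iota_uniq // => -[a b] [c d] _ _ [-> ->]. Qed.

Lemma size_grid m : size (grid m) = m * m.
Proof. by rewrite size_allpairs size_iota. Qed.

Lemma size_hook x z r : size (hook x z r) = r.*2.+1.
Proof. by rewrite size_cat !size_map !size_iota; lia. Qed.

Lemma mem_hook x z r p :
  (p \in hook x z r) =
  [&& x <= p.1, z <= p.2, p.1 <= x + r, p.2 <= z + r &
      (p.1 == x + r) || (p.2 == z + r)].
Proof.
case: p => X Z /=; rewrite mem_cat; apply/orP/idP => [[]|H].
- by case/mapP=> k; rewrite mem_iota => km [-> ->]; lia.
- by case/mapP=> k; rewrite mem_iota => km [-> ->]; lia.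
have [e|e] := eqVneq Z (z + r).
  left; apply/mapP; exists (X - x); rewrite ?mem_iota; first lia.
  by congr pair; lia.
right; apply/mapP; exists (Z - z); rewrite ?mem_iota; first lia.
by congr pair; lia.
Qed.

Section Search.
Import Order.TTheory GRing.Theory Num.Theory.
Local Open Scope ring_scope.
Variables (Q : Type) (pt : cell -> Q) (m c : nat).

(** Sampled cells outside the grid count as zeros and cost no query. *)
Fixpoint probe (s : seq cell) (k : nat) : prog Q (option cell) :=
  if k is k'.+1 then
    bind (draw Q (0%N, 0%N) s) (fun p =>
      if in_grid m p then
        Ask (pt p) (fun v => if v then Ret Q (Some p) else probe s k')
      else probe s k')
  else Ret Q None.

Fixpoint search (fuel x z r : nat) : prog Q (seq cell) :=
  if fuel is fuel'.+1 then
    bind (probe (hook x z r) c) (fun o =>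
      if o is Some p then
        bind (search fuel' p.1.+1 p.2.+1 0) (fun S => Ret Q (p :: S))
      else search fuel' x z r.+1)
  else Ret Q [::].

Lemma probe_queries s k : queries_le (probe s k) k.
Proof.
elim: k => //= k IH; rewrite /draw /= => i; case: ifP => _ /=.
  by split=> // -[] //=; exact: IH.
exact: queries_le_mono IH.
Qed.

Lemma search_queries fuel x z r : queries_le (search fuel x z r) (fuel * c)%N.
Proof.
elim: fuel x z r => //= fuel IH x z r; rewrite mulSn.
apply: queries_le_bind; first exact: probe_queries.
case=> [p|] //; rewrite -[(_ * _)%N]addn0.
by apply: queries_le_bind.
Qed.

Variable O : Q -> bool.

Definition is_one (q : cell) : bool := in_grid m q && O (pt q).

Lemma probe_always s k :
  always O (probe s k) (fun o => if o is Some p then is_one p else True).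
Proof.
elim: k => //= k IH; rewrite /draw /= => i _; case: ifP => //= ig.
by case: ifP => //= v; rewrite /is_one ig v.
Qed.

Lemma search_always fuel x z r : always O (search fuel x z r) (fun S => all is_one S).
Proof.
elim: fuel x z r => //= fuel IH x z r.
apply: always_bind (probe_always _ _) _ => -[p op|_] //.
by apply: always_bind (IH _ _ _) _ => S /= ->; rewrite op.
Qed.

(* The search is at the corner (x, z) and about to sample the hook of radius r;
   ones outside the quadrant of the corner or on smaller hooks are accounted for
   earlier. *)
Definition missed (x z r : nat) (S : seq cell) : nat :=
  count (fun q => [&& is_one q, x <= q.1, z <= q.2, (x + r <= q.1) || (z + r <= q.2)
                    & ~~ has (ccomparable q) S])%N (grid m).

Variable R : realFieldType.

Lemma sum_if_le (s : seq cell) (P : pred cell) (F : cell -> R) (M e : R) :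
  (forall p, p \in s -> P p -> F p <= M) ->
  \sum_(p <- s) (if P p then F p else e) <=
  (count P s)%:R * M + ((size s)%:R - (count P s)%:R) * e.
Proof.
elim: s => [|p s IH] FM; first by rewrite big_nil /= subrr !mul0r addr0.
have {}IH := IH (fun q qs => FM q (mem_behead (s := p :: s) qs)).
rewrite big_cons /= -[(size s).+1%:R]natr1; case: ifP => Pp /=.
  by have := FM p (mem_head _ _) Pp; rewrite add1n -natr1; lra.
by rewrite add0n; lra.
Qed.

(** [u] is the density of ones in [s]; all [k] independent samples fail with probability
    [(1 - u) ^+ k]. *)
Lemma probe_expect s k (phi : option cell -> R) (M M' u : R) :
  (0 < size s)%N -> u * (size s)%:R = (count is_one s)%:R ->
  (forall p, p \in s -> is_one p -> phi (Some p) <= M) -> phi None <= M' ->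
  expect O (probe s k) phi <= (1 - (1 - u) ^+ k) * M + (1 - u) ^+ k * M'.
Proof.
move=> s0 us HM HM'.
have s0R : 0 < (size s)%:R :> R by rewrite ltr0n.
have u1 : u <= 1.
  by rewrite -(ler_pM2r s0R) us mul1r ler_nat count_size.
elim: k => [|k IH]; first by rewrite expr0 subrr mul0r add0r mul1r.
have -> : expect O (probe s k.+1) phi = (size s)%:R^-1 *
    \sum_(p <- s) (if is_one p then phi (Some p) else expect O (probe s k) phi).
  rewrite [LHS](expect_draw O _ _ phi s0); congr (_ * _).
  by apply: eq_bigr => p _; rewrite /is_one; case: ifP => //= _; case: (O _).
rewrite mulrC ler_pdivrMr //.
apply: (le_trans (sum_if_le _ HM)).
rewrite -us exprS; set e := expect _ _ _ in IH *; set y := (1 - u) ^+ k in IH *.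
have : (1 - u) * e <= (1 - u) * ((1 - y) * M + y * M').
  by apply: ler_wpM2l => //; lra.
move=> /(ler_wpM2r (ltW s0R)); lra.
Qed.

(** The right side is the sum of [u * (1 - u) ^+ j] over [j < k], and each of these [k] terms is at
    least [u * (1 - u) ^+ k]. *)
Lemma nat_mul_expr_le (u : R) k :
  0 <= u <= 1 -> k%:R * u * (1 - u) ^+ k <= 1 - (1 - u) ^+ k.
Proof.
move=> /andP[u0 u1]; elim: k => [|k IH]; first by rewrite expr0; lra.
have q0 : 0 <= (1 - u) ^+ k by apply: exprn_ge0; lra.
have q1 : 0 <= k%:R * u * (1 - u) ^+ k by rewrite !mulr_ge0.
rewrite exprS -natr1.
move: q0 q1 IH; set y := _ ^+ k => q0 q1 IH.
have h1 : 0 <= u * (k%:R * u * y) by rewrite mulr_ge0.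
have h2 : 0 <= u * (u * y) by rewrite !mulr_ge0.
lra.
Qed.

(** A cell incomparable to [p] is strictly smaller or strictly larger in both coordinates; strictly
    smaller cells of the quadrant lie on hooks of radius below [r]. *)
Lemma missed_found x z r p S :
  (p \in hook x z r) -> (missed x z r (p :: S) <= missed p.1.+1 p.2.+1 0 S)%N.
Proof.
case: p => a b; rewrite mem_hook => ph; apply: sub_count => -[X Z] /=.
rewrite /ccomparable /cle negb_or => /and5P[-> h1 h2 h3 /andP[h4 ->]].
rewrite /= in ph h1 h2 h3 h4 *; lia.
Qed.

Lemma missed_next x z r S :
  (missed x z r S <= count is_one (hook x z r) + missed x z r.+1 S)%N.
Proof.
pose E q := is_one q && (q \in hook x z r).
apply: (@leq_trans (count (predU E (fun q =>
   [&& is_one q, x <= q.1, z <= q.2, (x + r.+1 <= q.1) || (z + r.+1 <= q.2)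
                    & ~~ has (ccomparable q) S])%N) (grid m))).
  apply: sub_count => -[X Z] /and5P[h1 h2 h3 h4 h5].
  by rewrite /= /E h1 h5 mem_hook; rewrite /= in h2 h3 h4 *; lia.
rewrite (leq_trans (leq_addr (count (predI E (fun q =>
   [&& is_one q, x <= q.1, z <= q.2, (x + r.+1 <= q.1) || (z + r.+1 <= q.2)
                    & ~~ has (ccomparable q) S])%N) (grid m)) _)) //.
rewrite count_predUI leq_add2r -!size_filter.
apply: uniq_leq_size; first by rewrite filter_uniq // grid_uniq.
by move=> q; rewrite !mem_filter => /andP[/andP[-> ->]].
Qed.

(* A radius that is given up costs its undetected ones; their expected number
   is paid for, via [nat_mul_expr_le], by the chance of having advanced the
   corner by more than the radius. *)
Lemma search_missed fuel x z r :
  (0 < c)%N -> (x <= m)%N -> (z <= m)%N -> (2 * m <= x + z + r + fuel)%N ->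
  expect O (search fuel x z r) (fun S => (missed x z r S)%:R : R)
    <= 2 / c%:R * (2 * m - x - z)%:R.
Proof.
move=> c0; have c0R : 0 < c%:R :> R by rewrite ltr0n.
elim: fuel x z r => [|fuel IH] x z r xm zm fl.
  (* Without fuel both [x + r] and [z + r] are at least [m], so no grid cell is left. *)
  rewrite /= /missed (@eq_in_count _ _ pred0) ?count_pred0.
    by rewrite mulr_ge0 ?divr_ge0.
  move=> q; rewrite mem_grid /in_grid => /andP[q1 q2]; apply/negbTE/negP.
  by case/and5P; lia.
set B : R := 2 / c%:R * (2 * m - x - z)%:R.
pose a := count is_one (hook x z r).
pose u : R := a%:R / r.*2.+1%:R.
have L0 : 0 < r.*2.+1%:R :> R by rewrite ltr0n.
have uL : u * r.*2.+1%:R = a%:R by rewrite divfK ?gt_eqF.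
have u01 : 0 <= u <= 1.
  rewrite divr_ge0 //= ler_pdivrMr // mul1r ler_nat.
  by rewrite -(size_hook x z r) count_size.
rewrite [search _ _ _ _]/= expect_bind.
(* A hit moves the corner just past the cell found, which raises [x + z] by at least [r + 2]. *)
apply: (le_trans (@probe_expect _ _ _ (B - 2 / c%:R * (r + 2)%:R) (a%:R + B) u _ _ _ _)).
- by rewrite size_hook.
- by rewrite size_hook.
- case=> X Z ph /andP[/andP[/= p1 p2] _]; rewrite expect_bind /=.
  apply: (@le_trans _ _ (expect O (search fuel X.+1 Z.+1 0)
            (fun S => (missed X.+1 Z.+1 0 S)%:R : R))).
    apply: le_expect (alwaysT _ _) _ => S _.
    by rewrite ler_nat; exact: (missed_found _ ph).
  have := ph; rewrite mem_hook /= => ph'.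
  apply: (le_trans (IH _ _ _ _ _ _)); try lia.
  rewrite /B -mulrBr ler_wpM2l ?divr_ge0 // lerBrDr -natrD ler_nat; lia.
- apply: (@le_trans _ _ (expect O (search fuel x z r.+1)
            (fun S => a%:R + 1 * (missed x z r.+1 S)%:R : R))).
    apply: le_expect (alwaysT _ _) _ => S _.
    by rewrite mul1r -natrD ler_nat; exact: missed_next.
  rewrite expectZD mul1r lerD2l; apply: IH; lia.
have key := nat_mul_expr_le c u01.
pose y : R := (1 - u) ^+ c; rewrite -/y in key *.
(* By [key] the expected loss [y * a] is at most [(1 - y) * (2 * r + 1) / c], and
   [2 * r + 1 <= 2 * (r + 2)]. *)
suff : y * a%:R <= (1 - y) * (2 / c%:R * (r + 2)%:R) by lra.
have /andP[u0 u1] := u01.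
have y1 : 0 <= 1 - y.
  have y0 : 0 <= y by apply: exprn_ge0; rewrite subr_ge0.
  by apply: le_trans key; apply: mulr_ge0 => //; apply: mulr_ge0 => //; exact: ltW.
rewrite -uL -(ler_pM2l c0R).
have e1 (C Y W : R) : C != 0 -> C * (Y * (2 / C * W)) = Y * (2 * W).
  by move=> C0; field.
have e2 (C Y U W : R) : C * (Y * (U * W)) = C * U * Y * W by ring.
rewrite e1 ?gt_eqF // e2.
apply: le_trans (ler_wpM2r (ltW L0) key) _.
apply: ler_wpM2l => //; rewrite -natrM ler_nat; lia.
Qed.

End Search.

(** * Learning and checking *)

Section Learn.
Variables (Q : Type) (m c : nat).

(* Invariant: in the rows z and beyond, the cells of D left of column i are
   zeros. *)
Fixpoint walk (pt : cell -> Q) (D : pred cell) (fuel i z : nat) :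
    prog Q (pred cell) :=
  if fuel is fuel'.+1 then
    let next := bind (walk pt D fuel' i z.+1) (fun h =>
      Ret Q (fun q => if q.2 == z then i <= q.1 else h q)) in
    if D (i, z) then
      Ask (pt (i, z)) (fun v => if v then next else walk pt D fuel' i.+1 z)
    else next
  else Ret Q (fun _ : cell => false).

Lemma walk_queries pt D fuel i z : queries_le (walk pt D fuel i z) fuel.
Proof.
elim: fuel i z => //= fuel IH i z.
have nx : queries_le (bind (walk pt D fuel i z.+1) (fun h =>
    Ret Q (fun q => if q.2 == z then i <= q.1 else h q))) fuel.
  by rewrite -[X in queries_le _ X]addn0; exact: queries_le_bind.
case: ifP => _ /=; last exact: queries_le_mono nx.
by split=> // -[].
Qed.

(** A one at [(i, z)] settles the rest of row [z], a zero settles column [i] in all remaining rows,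
    and if [(i, z)] is outside [D] so is the rest of its row. Every step thus discards a row or a
    column. *)
Lemma walk_always (O : Q -> bool) pt (D : pred cell) fuel i z :
  (forall q, D q -> in_grid m q) ->
  (forall p q, D q -> cle p q -> p.2 < m -> D p) ->
  (forall p q, D p -> D q -> cle p q -> O (pt p) -> O (pt q)) ->
  (forall q, D q -> z <= q.2 -> q.1 < i -> ~~ O (pt q)) ->
  2 * m <= i + z + fuel ->
  always O (walk pt D fuel i z)
    (fun h => forall q, D q -> z <= q.2 -> h q = O (pt q)).
Proof.
move=> Dm Dc Om; elim: fuel i z => [|fuel IH] i z inv fl /=.
  move=> [X Z] Dq /= zZ; apply/esym/negbTE/inv => //=.
  by have := Dm _ Dq; rewrite /in_grid /=; lia.
have nx : (D (i, z) -> O (pt (i, z))) ->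
    always O (bind (walk pt D fuel i z.+1) (fun h =>
      Ret Q (fun q => if q.2 == z then i <= q.1 else h q)))
    (fun h => forall q, D q -> z <= q.2 -> h q = O (pt q)).
  move=> Diz; apply: always_bind.
    apply: IH; last by lia.
    by move=> q Dq zq; apply: inv => //; exact: ltnW.
  move=> h hE [X Z] Dq /= zZ; case: eqP => [Zz|nZz]; last first.
    by apply: hE => //=; lia.
  have := Dm _ Dq; rewrite /in_grid /= => /andP[Xm Zm].
  case: (leqP i X) => [iX|Xi]; last by apply/esym/negbTE/inv.
  have c1 : cle (i, z) (X, Z) by rewrite /cle /= iX Zz leqnn.
  have Di : D (i, z) by apply: Dc Dq c1 _; rewrite /= -Zz.
  by apply/esym/(Om _ _ Di Dq c1)/Diz.
case: ifP => [Diz|nD]; last by apply: nx; rewrite nD.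
rewrite /=; case: ifP => [v|v]; first by apply: nx.
apply: IH; last by lia.
move=> [X Z] Dq /= zZ; rewrite ltnS leq_eqVlt => /orP[/eqP Xi|Xi]; last exact: inv.
by apply/negP => /(Om _ _ Dq Diz); rewrite v /cle /= Xi leqnn zZ => /(_ isT).
Qed.

(** [cle q s] with [s] in the grid bounds [q.1] but not [q.2], hence the explicit bound; in [above]
    the roles are exchanged. *)
Definition below (S : seq cell) (q : cell) : bool := (q.2 < m) && has (cle q) S.

Definition above (S : seq cell) (q : cell) : bool := (q.1 < m) && has (cle^~ q) S.

(** This reflection reverses [cle], so a function antitone above the seeds becomes monotone and the
    same [walk] applies. *)
Definition swap (q : cell) : cell := (q.2, q.1).

Variable pt : cell -> Q.

Definition learn : prog Q (seq cell * pred cell) :=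
  bind (search pt m c (2 * m) 0 0 0) (fun S =>
  bind (walk pt (below S) (2 * m) 0 0) (fun hd =>
  bind (walk (pt \o swap) (above S \o swap) (2 * m) 0 0) (fun hu =>
  Ret Q (S, fun q => below S q && hd q || above S q && hu (swap q))))).

Lemma learn_queries : queries_le learn (2 * m * c + (2 * m + (2 * m + 0))).
Proof.
apply: queries_le_bind; first exact: search_queries.
move=> S; apply: queries_le_bind; first exact: walk_queries.
by move=> hd; apply: queries_le_bind; first exact: walk_queries.
Qed.

Variable O : Q -> bool.

Let oneO := is_one pt m O.

Lemma cle_trans q p r : cle p q -> cle q r -> cle p r.
Proof. by rewrite /cle => /andP[a b] /andP[d e]; rewrite (leq_trans a) ?(leq_trans e). Qed.

(** Convexity makes [O] monotone below the seeds, since a cell between a one and a seed is a one;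
    dually it is antitone above them. *)
Lemma learn_always :
  (forall p q r, cle p q -> cle q r -> oneO p -> oneO r -> oneO q) ->
  always O learn (fun a => forall q, in_grid m q ->
    a.2 q = oneO q && has (ccomparable q) a.1).
Proof.
move=> conv; apply: always_bind (search_always pt m c O _ _ _ _) _ => S Sone.
have Sin s : s \in S -> in_grid m s by move/(allP Sone)/andP => [].
pose PD (h : pred cell) := forall q, below S q -> h q = O (pt q).
apply: (@always_bind _ _ _ _ _ _ PD).
  apply: (@always_impl _ _ _ _ (fun h =>
      forall q, below S q -> 0 <= q.2 -> h q = O (pt q))).
    by move=> h hE q qS; exact: hE.
  apply: walk_always => //.
  - move=> q /andP[q2 /hasP[s /Sin /andP[s1 _] /andP[h1 _]]].
    by rewrite /in_grid q2 (leq_ltn_trans h1).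
  - move=> p q /andP[q2 /hasP[s sS qs]] pq pm; rewrite /below pm.
    by apply/hasP; exists s => //; exact: cle_trans qs.
  - move=> p q /andP[p2 /hasP[t tS pt']] /andP[q2 /hasP[s sS qs]] pq Op.
    have sone := allP Sone _ sS.
    suff /andP[] : oneO q by [].
    apply: conv pq qs _ sone; rewrite /oneO /is_one Op andbT /in_grid p2 andbT.
    by apply: leq_ltn_trans (proj1 (andP pt')) _; have /andP[] := Sin _ tS.
move=> hd hdE.
pose PU (h : pred cell) := forall q, above S q -> h (swap q) = O (pt q).
apply: (@always_bind _ _ _ _ _ _ PU).
  apply: (@always_impl _ _ _ _ (fun h => forall q, (above S \o swap) q -> 0 <= q.2 ->
      h q = O ((pt \o swap) q))).
    by move=> h hE [X Z] qS; exact: (hE (Z, X)).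
  apply: walk_always => //.
  - move=> [Z X] /andP[/= q2 /hasP[s /Sin /andP[_ s2] /andP[/= _ h2]]].
    by rewrite /in_grid /= q2 andbT (leq_ltn_trans h2).
  - move=> [Z X] [Z' X'] /andP[/= q2 /hasP[s sS qs]] /andP[/= pq pq'] pm.
    rewrite /above /= pm; apply/hasP; exists s => //; apply: cle_trans qs _.
    by rewrite /cle /= pq pq'.
  - move=> [Z X] [Z' X'] /andP[/= p2 /hasP[t tS pt']] /andP[/= q2 /hasP[s sS qs]].
    move=> /andP[/= pq pq'] Op.
    have sone := allP Sone _ sS.
    suff /andP[] : oneO (X', Z') by [].
    apply: (conv s _ (X, Z)) => //; first by rewrite /cle /= pq pq'.
    rewrite /oneO /is_one Op andbT /in_grid /= p2 /=.
    by apply: leq_ltn_trans (proj2 (andP pt')) _; have /andP[] := Sin _ tS.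
move=> hu huE /= q qg; have /andP[q1 q2] := qg.
have -> : has (ccomparable q) S = below S q || above S q.
  by rewrite /below /above q1 q2 /= -has_predU; apply: eq_has.
have -> : oneO q = O (pt q) by rewrite /oneO /is_one qg.
have := hdE q; have := huE q.
by case: (below S q) (above S q) => -[] //= h1 h2;
  rewrite ?h1 ?h2 ?andbT ?andbF ?orbF ?orbb.
Qed.

End Learn.

Section Check.
Import Order.TTheory GRing.Theory Num.Theory.
Local Open Scope ring_scope.

Lemma learn_missed (Q : Type) (m c : nat) (pt : cell -> Q) (O : Q -> bool)
    (R : realFieldType) :
  (0 < c)%N ->
  expect O (learn m c pt) (fun a => (missed pt m O 0 0 0 a.1)%:R : R) <=
  2 / c%:R * (2 * m)%:R.
Proof.
move=> c0.
have := @search_missed Q pt m c O R (2 * m)%N 0%N 0%N 0%N c0 (leq0n _) (leq0n _).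
rewrite !subn0 => /(_ (leqnn _)); apply: le_trans.
rewrite /learn expect_bind; apply: le_expect (alwaysT _ _) _ => S _.
rewrite expect_bind -[X in _ <= X](expect_cst O (walk pt (below m S) (2 * m) 0 0)).
apply: le_expect (alwaysT _ _) _ => hd _.
by rewrite expect_bind /= expect_cst.
Qed.

(** * Random comparison with a hypothesis *)

Variable n : nat.

Fixpoint check (H : pred (point n.+1)) (k : nat) : prog (point n.+1) bool :=
  if k is k'.+1 then
    bind (draw _ (ord0, ord0) (enum {: point n.+1})) (fun x =>
      Ask x (fun v => if v == H x then check H k' else Ret _ false))
  else Ret _ true.

Lemma check_queries H k : queries_le (check H k) k.
Proof.
elim: k => //= k IH; rewrite /draw /= => i; split=> // v; by case: ifP.
Qed.

Variables (R : realFieldType) (f : point n.+1 -> bool).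

Definition distance (H : pred (point n.+1)) : R :=
  (hamming f H)%:R / (n.+1 * n.+1)%:R.

Lemma distance_bounds H : 0 <= distance H <= 1.
Proof.
rewrite /distance divr_ge0 //= ler_pdivrMr ?ltr0n // mul1r ler_nat.
by rewrite (leq_trans (max_card _)) // card_prod card_ord.
Qed.

Lemma check_expect H k :
  expect f (check H k) (fun b : bool => b%:R : R) = (1 - distance H) ^+ k.
Proof.
have sz : size (enum {: point n.+1}) = (n.+1 * n.+1)%N.
  by rewrite -cardE card_prod card_ord.
elim: k => [|k IH]; first by rewrite expr0.
have s0 : (0 < size (enum {: point n.+1}))%N by rewrite sz.
rewrite [LHS](expect_draw f _ _ _ s0) sz exprS -IH big_enum /=.
set e := expect _ _ _.
rewrite (eq_bigr (fun x => e - (f x != H x)%:R * e)); last first.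
  by move=> x _; case: eqP => /= _; rewrite ?mul0r ?subr0 ?mul1r ?subrr.
have ham : \sum_x (f x != H x)%:R = (hamming f H)%:R :> R.
  by rewrite -natr_sum -big_mkcond sum1_card.
rewrite sumrB sumr_const card_prod card_ord -mulr_suml ham -[e *+ _]mulr_natl.
have : (n.+1 * n.+1)%:R != 0 :> R by rewrite pnatr_eq0.
rewrite /distance; move: (n.+1 * n.+1)%:R (hamming f H)%:R => L h L0.
by field.
Qed.

Lemma bernoulli (d : R) k : 0 <= d <= 1 -> 1 - k%:R * d <= (1 - d) ^+ k.
Proof.
move=> /andP[d0 d1]; elim: k => [|k IH]; first by rewrite mul0r subr0 expr0.
rewrite exprS -natr1.
have : (1 - d) * (1 - k%:R * d) <= (1 - d) * (1 - d) ^+ k.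
  by apply: ler_wpM2l IH; lra.
have : 0 <= k%:R * (d * d) by rewrite !mulr_ge0.
lra.
Qed.

Lemma expr_le_third (d : R) k :
  0 <= d <= 1 -> 2 <= k%:R * d -> (1 - d) ^+ k <= 1 / 3.
Proof.
move=> /andP[d0 d1] kd.
have y0 : 0 <= (1 - d) ^+ k by apply: exprn_ge0; lra.
(* Induction by [(1 - d) * (1 + (k + 1) * d) <= 1 + k * d]; as [k * d >= 2], the second factor is at
   least 3. *)
have : (1 - d) ^+ k * (1 + k%:R * d) <= 1.
  elim: k {kd y0} => [|k IH]; first by rewrite expr0; lra.
  apply: le_trans IH; rewrite exprSr -mulrA ler_wpM2l ?exprn_ge0 ?subr_ge0 //.
  have : 0 <= k%:R * (d * d) by rewrite !mulr_ge0.
  have : 0 <= d * d by rewrite mulr_ge0.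
  rewrite -natr1; lra.
nra.
Qed.

End Check.

(** * Blocks *)

Lemma card_le_size (T : finType) (U : eqType) (A : pred T) (g : T -> U) (L : seq U) :
  {in A &, injective g} -> (forall x, x \in A -> g x \in L) -> #|A| <= size L.
Proof.
move=> ginj gL; rewrite cardE -(size_map g); apply: uniq_leq_size.
  rewrite map_inj_in_uniq ?enum_uniq // => x y.
  by rewrite !mem_enum; exact: ginj.
by move=> _ /mapP[x xA ->]; apply: gL; rewrite mem_enum in xA.
Qed.

Section Blocks.
Variables (n b : nat).
Hypothesis b0 : 0 < b.

Definition blocks : nat := (n %/ b).+1.

(* The second coordinate of a cell is the block row counted from the top, so
   that incomparable cells are strictly ordered in both coordinates. *)
Definition cell_of (x : point n.+1) : cell := (x.1 %/ b, n %/ b - x.2 %/ b).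

Definition corner (q : cell) : point n.+1 :=
  (inord (q.1 * b), inord ((n %/ b - q.2) * b)).

Definition hull (h : pred cell) : pred (point n.+1) := fun x =>
  [exists y, exists w, [&& ple y x, ple x w, h (cell_of y) & h (cell_of w)]].

Lemma hullP (h : pred cell) x :
  reflect (exists y w, [/\ ple y x, ple x w, h (cell_of y) & h (cell_of w)]) (hull h x).
Proof.
apply: (iffP existsP) => [[y /existsP[w /and4P[]]]|[y [w [yx xw hy hw]]]].
  by exists y, w.
by exists y; apply/existsP; exists w; rewrite yx xw hy hw.
Qed.

Lemma ple_trans N (y x w : point N) : ple x y -> ple y w -> ple x w.
Proof.
by rewrite /ple => /andP[p q] /andP[r s]; rewrite (leq_trans p r) (leq_trans q s).
Qed.

Lemma ple_refl N (x : point N) : ple x x.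
Proof. by rewrite /ple !leqnn. Qed.

Lemma hull_two_monotone h : two_monotone (hull h).
Proof.
case=> x1 [x2 [x3 [x12 x23 hx1 hx2 hx3]]].
have /hullP[y [w [yx _ hy _]]] : hull h x1 := hx1.
have /hullP[y' [w' [_ xw _ hw]]] : hull h x3 := hx3.
suff : hull h x2 by rewrite hx2.
apply/hullP.
by exists y, w'; split=> //; [exact: ple_trans yx x12|exact: ple_trans x23 xw].
Qed.

Lemma div_le (x : 'I_n.+1) : x %/ b <= n %/ b.
Proof. by apply: leq_div2r; rewrite -ltnS. Qed.

Lemma cell_of_mono x y : ple x y -> cle (cell_of x) (cell_of y).
Proof.
by move=> /andP[p q]; rewrite /cle /= leq_div2r //= leq_sub2l // leq_div2r.
Qed.

Lemma cell_of_grid x : in_grid blocks (cell_of x).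
Proof. by rewrite /in_grid /= !ltnS div_le leq_subr. Qed.

Lemma mul_le k : k <= n %/ b -> k * b <= n.
Proof. by move=> kn; rewrite -leq_divRL. Qed.

Lemma corner_val q : in_grid blocks q ->
  (corner q).1 = q.1 * b :> nat /\ (corner q).2 = (n %/ b - q.2) * b :> nat.
Proof.
move=> /andP[q1 q2]; rewrite /= !inordK // ltnS; apply: mul_le => //.
by rewrite leq_subr.
Qed.

Lemma corner_mono p q : in_grid blocks p -> in_grid blocks q -> cle p q ->
  ple (corner p) (corner q).
Proof.
move=> pg qg /andP[pq1 pq2]; rewrite /ple.
have [-> ->] := corner_val pg; have [-> ->] := corner_val qg.
by rewrite !leq_mul2r pq1 leq_sub2l // !orbT.
Qed.

Lemma corner_cell_of x :
  (corner (cell_of x)).1 = x.1 %/ b * b :> nat /\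
  (corner (cell_of x)).2 = x.2 %/ b * b :> nat.
Proof.
by have [-> ->] := corner_val (cell_of_grid x); rewrite /= subKn ?div_le.
Qed.

Lemma corner_ple x : ple (corner (cell_of x)) x.
Proof. by rewrite /ple; have [-> ->] := corner_cell_of x; rewrite !leq_divM. Qed.

Lemma cell_of_inj x y :
  cell_of x = cell_of y -> x.1 %% b = y.1 %% b -> x.2 %% b = y.2 %% b -> x = y.
Proof.
move=> [e1 e2] m1 m2.
have {}e2 : x.2 %/ b = y.2 %/ b by have := div_le x.2; have := div_le y.2; lia.
case: x y e1 e2 m1 m2 => [x1 x2] [y1 y2] /= e1 e2 m1 m2.
congr pair; apply: val_inj => /=.
  by rewrite (divn_eq x1 b) e1 m1 -divn_eq.
by rewrite (divn_eq x2 b) e2 m2 -divn_eq.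
Qed.

Lemma card_cells (P : pred cell) :
  #|[pred x | P (cell_of x)]| <= count P (grid blocks) * (b * b).
Proof.
rewrite -size_grid -size_filter.
rewrite -(size_allpairs (fun q w => (q, w)) [seq q <- grid blocks | P q] (grid b)).
apply: (@card_le_size _ _ _ (fun x => (cell_of x, (x.1 %% b, x.2 %% b)))).
  by move=> x y _ _ [e1 e2 e3 e4]; apply: cell_of_inj => //; rewrite /cell_of e1 e2.
move=> x Px; apply/allpairsP; exists (cell_of x, (x.1 %% b, x.2 %% b)); split; last by [].
  by rewrite mem_filter mem_grid cell_of_grid andbT.
by rewrite mem_grid /in_grid /= !ltn_mod b0.
Qed.

Variable f : point n.+1 -> bool.

Definition unaligned : pred (point n.+1) := [pred x | f x != f (corner (cell_of x))].

Lemma unaligned_trivial : b = 1 -> #|unaligned| = 0.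
Proof.
move=> b1; apply: eq_card0 => x; rewrite inE.
suff -> : corner (cell_of x) = x by rewrite eqxx.
have [e1 e2] := corner_cell_of x; rewrite b1 !divn1 !muln1 in e1 e2.
by case: x e1 e2 => [x1 x2] e1 e2; congr pair; exact: val_inj.
Qed.

Hypothesis fm : two_monotone f.

Lemma two_monotone_conv x1 x2 x3 : ple x1 x2 -> ple x2 x3 -> f x1 -> f x3 -> f x2.
Proof.
move=> h12 h23 f1 f3; case f2 : (f x2) => //.
by exfalso; apply: fm; exists x1, x2, x3.
Qed.

(* Two unaligned points x, y with the same value and the same offset, whose
   blocks are on the same diagonal, lie on a chain of the form
   corner x <= x <= corner y <= y, on which f would alternate. *)
Lemma unaligned_next x y :
  x \in unaligned -> y \in unaligned -> f x = f y ->
  x.1 %/ b < y.1 %/ b -> x.2 %/ b < y.2 %/ b -> False.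
Proof.
rewrite !inE => ux uy fxy d1 d2.
have xy : ple x (corner (cell_of y)).
  have le k l : k %/ b < l %/ b -> k <= l %/ b * b.
    move=> kl; apply: ltnW; apply: leq_trans (ltn_ceil k b0) _.
    by rewrite leq_mul2r kl orbT.
  by rewrite /ple; have [-> ->] := corner_cell_of y; rewrite !le.
case fx : (f x) ux uy fxy => ux uy fxy.
  move: uy; rewrite -fxy (two_monotone_conv xy (corner_ple y)) ?fx //.
move: ux uy; rewrite -fxy; case E : (f (corner (cell_of x))) => // _.
case F : (f (corner (cell_of y))) => // _.
by have := two_monotone_conv (corner_ple x) xy E F; rewrite fx.
Qed.

(** An unaligned point is determined by its value, its diagonal of blocks and its offset: distinct
    blocks on one diagonal are strictly ordered in both coordinates, which [unaligned_next]
    excludes. *)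
Lemma card_unaligned : #|unaligned| <= 4 * blocks * (b * b).
Proof.
have -> : 4 * blocks * (b * b) =
    size [seq (v, w) | v <- [seq (u, d) | u <- [:: false; true],
                                            d <- iota 0 (2 * blocks)],
                       w <- grid b].
  by rewrite !size_allpairs !size_iota; congr (_ * _)%N; rewrite mulnA.
apply: (@card_le_size _ _ _ (fun x =>
  ((f x, (cell_of x).1 + (cell_of x).2), (x.1 %% b, x.2 %% b)))); last first.
  move=> x _; apply/allpairsP.
  exists ((f x, (cell_of x).1 + (cell_of x).2), (x.1 %% b, x.2 %% b)); split; last by [].
    apply/allpairsP; exists (f x, (cell_of x).1 + (cell_of x).2); split; last by [].
      by rewrite !inE; case: (f x).
    rewrite mem_iota add0n /= mul2n -addnn -addSn.
    by apply: leq_add; [exact: div_le | exact/leqW/leq_subr].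
  by rewrite mem_grid /in_grid /= !ltn_mod b0.
move=> [x1 x2] [y1 y2] ux uy [fxy /= e m1 m2].
have dx := div_le x2; have dy := div_le y2.
case: (ltngtP (x1 %/ b) (y1 %/ b)) => l; last first.
- by apply: cell_of_inj => //; rewrite /cell_of /= l; congr pair; lia.
- by exfalso; apply: unaligned_next uy ux (esym fxy) _ _ => //=; lia.
- by exfalso; apply: unaligned_next ux uy fxy _ _ => //=; lia.
Qed.

Lemma is_one_conv p q r :
  cle p q -> cle q r -> is_one corner blocks f p -> is_one corner blocks f r ->
  is_one corner blocks f q.
Proof.
move=> pq qr /andP[pg fp] /andP[rg fr].
have qg : in_grid blocks q.
  move: pg rg pq qr; rewrite /in_grid /cle => /andP[_ p2] /andP[r1 _].
  by move=> /andP[_ h1] /andP[h2 _]; rewrite (leq_ltn_trans h2) // (leq_ltn_trans h1).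
rewrite /is_one qg /=.
by apply: two_monotone_conv fp fr; exact: corner_mono.
Qed.

(** An aligned point of the hull has its cell between two learned ones, so by convexity [f] is one
    there. An aligned disagreement is therefore a one outside the hull, and its cell was missed. *)
Lemma hamming_hull S (h : pred cell) :
  (forall q, in_grid blocks q ->
    h q = is_one corner blocks f q && has (ccomparable q) S) ->
  hamming f (hull h) <= #|unaligned| + missed corner blocks f 0 0 0 S * (b * b).
Proof.
move=> hE; rewrite (leq_trans _ (leq_add (leqnn _) (card_cells _))) //.
pose M q := [&& is_one corner blocks f q, 0 <= q.1, 0 <= q.2,
  (0 + 0 <= q.1) || (0 + 0 <= q.2) & ~~ has (ccomparable q) S].
rewrite -(cardUI unaligned [pred x | M (cell_of x)]); apply: leq_trans (leq_addr _ _).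
apply: subset_leq_card; apply/subsetP => x.
rewrite !inE; case: (f x =P f (corner (cell_of x))) => //= fx.
have one_cell z : is_one corner blocks f (cell_of z) = f (corner (cell_of z)).
  by rewrite /is_one cell_of_grid.
case: (hullP h x) => [[y [w [yx xw]]]|nh].
  rewrite !hE ?cell_of_grid // => /andP[y1 _] /andP[w1 _].
  have := is_one_conv (cell_of_mono yx) (cell_of_mono xw) y1 w1.
  by rewrite one_cell -fx => ->.
rewrite /M; case Fx : (f x) => // _.
rewrite one_cell -fx Fx /=; apply/negP => cx; apply: nh.
by exists x, x; rewrite ple_refl hE ?cell_of_grid // one_cell -fx Fx.
Qed.
End Blocks.

(** * The tester *)

Section Tester.
Import Order.TTheory GRing.Theory Num.Theory.
Local Open Scope ring_scope.
Variables (n b c k : nat).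

Definition tester : prog (point n.+1) bool :=
  bind (learn (blocks n b) c (corner n b)) (fun a => check (hull b a.2) k).

Lemma tester_queries :
  queries_le tester (2 * blocks n b * c + 4 * blocks n b + k)%N.
Proof.
apply: queries_le_bind => [|a]; last exact: check_queries.
by apply: queries_le_mono (learn_queries _ _ _); lia.
Qed.

Variables (R : realFieldType) (f : point n.+1 -> bool).

(** The hull is 2-monotone, hence [eps]-far from [f], for every outcome of the learning; the bound
    holds conditionally on each outcome. *)
Lemma tester_far (eps : R) :
  2 <= k%:R * eps ->
  (forall H, two_monotone H -> eps <= distance R f H) ->
  expect f tester (fun v : bool => v%:R : R) <= 1 / 3.
Proof.
move=> keps far; rewrite /tester expect_bind.
rewrite -[1 / 3](expect_cst f (learn (blocks n b) c (corner n b))).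
apply: le_expect (alwaysT _ _) _ => a _; rewrite check_expect.
apply: expr_le_third; first exact: distance_bounds.
apply: le_trans keps _; apply: ler_wpM2l => //.
exact/far/hull_two_monotone.
Qed.

(** A union bound over the [k] comparisons. Up to denominators, the budget says that [k] times the
    unaligned points plus the expected missed cells (at most [4 * m / c], each of [b * b] points) is
    at most a third of the grid. *)
Lemma tester_near :
  (0 < b)%N -> (0 < c)%N -> two_monotone f ->
  (3 * k * (#|unaligned b f| * c + 4 * blocks n b * (b * b)) <= c * (n.+1 * n.+1))%N ->
  2 / 3 <= expect f tester (fun v : bool => v%:R : R).
Proof.
move=> b0 c0 fm; set m := blocks n b; set U := #|_|; rewrite -(ler_nat R).
rewrite !(natrM, natrD) => budget.
have c0R : 0 < c%:R :> R by rewrite ltr0n.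
pose L : R := n.+1%:R * n.+1%:R.
have L0 : 0 < L by rewrite mulr_gt0 ?ltr0n.
pose s : R := k%:R * (b%:R * b%:R) / L.
have s0 : 0 <= s by rewrite /s !mulr_ge0 // invr_ge0 ltW.
rewrite /tester expect_bind.
(* Bernoulli's bound is affine in the number of missed cells, so only its expectation matters. *)
apply: (@le_trans _ _ (expect f (learn m c (corner n b)) (fun a =>
    (1 - k%:R * U%:R / L) + (- s) * (missed (corner n b) m f 0 0 0 a.1)%:R : R))).
  rewrite expectZD; have := learn_missed m (corner n b) f R c0.
  set e := expect _ _ _ => eb.
  have {}eb : s * e <= s * (2 / c%:R * (2 * m%:R)).
    by apply: ler_wpM2l => //; apply: le_trans eb _; rewrite natrM.
  suff : k%:R * U%:R / L + s * (2 / c%:R * (2 * m%:R)) <= 1 / 3 by lra.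
  have -> : k%:R * U%:R / L + s * (2 / c%:R * (2 * m%:R)) =
      k%:R * (U%:R * c%:R + 4 * m%:R * (b%:R * b%:R)) / (c%:R * L).
    by rewrite /s; field; rewrite !gt_eqF.
  rewrite ler_pdivrMr ?mulr_gt0 //; rewrite -/L in budget; lra.
have conv p q r := @is_one_conv n b b0 f fm p q r.
suff pointwise a : (forall q, in_grid m q ->
      a.2 q = is_one (corner n b) m f q && has (ccomparable q) a.1) ->
    (1 - k%:R * U%:R / L) + (- s) * (missed (corner n b) m f 0 0 0 a.1)%:R <=
    expect f (check (hull b a.2) k) (fun v : bool => v%:R : R).
  exact: le_expect (learn_always c conv) pointwise.
move=> hE; rewrite check_expect; apply: le_trans (bernoulli _ (distance_bounds _ _ _)).
have := hamming_hull b0 fm hE; rewrite /distance -/m -/U.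
move: (missed _ _ _ _ _ _ _) (hamming _ _) => M h.
rewrite -(ler_nat R) !(natrM, natrD) -/L => hb.
have kL : 0 <= k%:R / L by rewrite divr_ge0 // ltW.
have := ler_wpM2l kL hb; rewrite /s.
move: h%:R M%:R U%:R k%:R b%:R {s s0 hb hE kL budget} => h' M' U' k' b'.
have -> : k' * (h' / L) = k' / L * h' by ring.
have -> : k' * (b' * b') / L = k' / L * (b' * b') by ring.
have -> : k' * U' / L = k' / L * U' by ring.
lra.
Qed.

End Tester.

(** * Choice of parameters *)

Definition block_size (n N : nat) : nat := maxn 1 (n.+1 %/ (96 * N)).

(** Ensures [repeats n N * n.+1 > 96 * N], and equals 1 as soon as blocks exceed a point. *)
Definition repeats (n N : nat) : nat := (96 * N) %/ n.+1 + 1.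

Lemma block_size_cases n N : 0 < N ->
  (block_size n N = 1 /\ n.+1 < 192 * N) \/
  [/\ 1 < block_size n N, block_size n N * (96 * N) <= n.+1,
      n.+1 < (block_size n N).+1 * (96 * N) & repeats n N = 1].
Proof.
move=> N0; rewrite /block_size /repeats.
have K0 : 0 < 96 * N by rewrite muln_gt0.
have lo := leq_divM n.+1 (96 * N); have hi := ltn_ceil n.+1 K0.
move: lo hi; set q := n.+1 %/ (96 * N) => lo hi.
case: (leqP q 1) => q1; [left|right].
  split=> //.
  apply: leq_trans hi _; apply: (@leq_trans (2 * (96 * N))); last by lia.
  by rewrite leq_mul2r; lia.
split => //.
rewrite divn_small //; apply: leq_trans lo; rewrite ltn_Pmull //.
Qed.

(** With unit blocks [m = n.+1 < 192 * N] and [2 * m * c <= 2 * m + 192 * N], whence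
    [6 * 192 + 192 + 2 = 1346]; larger blocks need [6 * 192 + 2]. *)
Lemma queries_budget n N : 0 < N ->
  2 * blocks n (block_size n N) * repeats n N + 4 * blocks n (block_size n N) + 2 * N
    <= 1346 * N.
Proof.
move=> N0; case: (block_size_cases n N0) => [[-> nN]|[b1 lo hi ->]].
  rewrite /blocks divn1 /repeats.
  have := leq_divM (96 * N) n.+1; nia.
have : n %/ block_size n N < 192 * N; last by rewrite /blocks; lia.
rewrite ltn_divLR; last exact: ltnW.
nia.
Qed.

(** For larger blocks [m * b <= 2 * n.+1] bounds the left side by [96 * N * b * n.+1], which is
    where 96 comes from. Unit blocks have no unaligned points. *)
Lemma error_budget n N (f : point n.+1 -> bool) : 0 < N -> two_monotone f ->
  3 * (2 * N) * (#|unaligned (block_size n N) f| * repeats n N +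
    4 * blocks n (block_size n N) * (block_size n N * block_size n N)) <=
  repeats n N * (n.+1 * n.+1).
Proof.
move=> N0 fm; case: (block_size_cases n N0) => [[-> nN]|[b1 lo hi ->]].
  rewrite unaligned_trivial // /blocks divn1.
  have : 96 * N < repeats n N * n.+1.
    by rewrite /repeats addn1; exact: ltn_ceil.
  nia.
have b0 : 0 < block_size n N by exact: ltnW.
have := card_unaligned b0 fm; have := leq_divM n (block_size n N).
rewrite /blocks; move: (block_size n N) (#|_|) lo b1 {b0 hi} => b U lo b1.
set d := n %/ b => db Ub.
have mb : d.+1 * b <= 2 * n.+1 by nia.
apply: (@leq_trans (48 * N * b * (d.+1 * b))); first by nia.
apply: (@leq_trans (48 * N * b * (2 * n.+1))); first by rewrite leq_mul2l mb orbT.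
by nia.
Qed.

Definition inv_ceil (eps : R) : nat := Z.to_nat (up (1 / eps)).

Lemma inv_ceil_bounds (eps : R) : (0 < eps < 1)%R ->
  (1 / eps <= INR (inv_ceil eps) <= 2 / eps)%R.
Proof.
move=> [e0 e1].
have [u1 u2] := archimed (1 / eps).
have i1 : (1 <= 1 / eps)%R.
  apply: (Rmult_le_reg_r eps) => //; rewrite /Rdiv Rmult_assoc Rinv_l; Lra.lra.
have -> : (2 / eps = 1 / eps + 1 / eps)%R by rewrite /Rdiv; Lra.lra.
rewrite /inv_ceil INR_IZR_INZ Znat.Z2Nat.id; first Lra.lra.
by apply: le_IZR; Lra.lra.
Qed.

Delimit Scope R_scope with R.

(* There is a constant C and a (two-sided, adaptive) tester which, given n and
   eps, is a distribution over decision trees making at most C/eps queries,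
   accepting 2-monotone f w.p. >= 2/3 and rejecting eps-far f w.p. >= 2/3. *)
Theorem theorem1p6 :
  exists (C : R) (T : forall n : nat, R -> rtester n),
    forall (n : nat) (eps : R), (0 < n)%N -> (0 < eps < 1)%R ->
      [/\ is_distribution (T n eps),
          query_bound (T n eps) (C / eps)%R,
          (forall f : point n -> bool, two_monotone f ->
             (2 / 3 <= accept_prob (T n eps) f)%R)
        & (forall f : point n -> bool, eps_far eps f ->
             (accept_prob (T n eps) f <= 1 / 3)%R)].
Proof.
(* [2692] is [2 * 1346], as [N <= 2 / eps]; the empty list is a placeholder for [n = 0]. *)
exists 2692%R, (fun n eps => if n is n'.+1 then
  let N := inv_ceil eps in
  compile (tester n' (block_size n' N) (repeats n' N) (2 * N)) else [::]).
move=> [//|n] eps _ eps01; have [N1 N2] := inv_ceil_bounds eps01.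
set N := inv_ceil eps in N1 N2 *; have [e0 e1] := eps01.
have Neps : (1 <= INR N * eps)%R.
  have -> : (1 = 1 / eps * eps)%R by rewrite /Rdiv Rmult_assoc Rinv_l; Lra.lra.
  by apply: Rmult_le_compat_r; Lra.lra.
have N0 : (0 < N)%N.
  by case: (N) Neps => //=; rewrite Rmult_0_l; Lra.lra.
set b := block_size n N; set c := repeats n N.
have b0 : (0 < b)%N by rewrite leq_maxl.
have c0 : (0 < c)%N by rewrite /c /repeats addn1.
split.
- by split; [exact: compile_ge0 | rewrite weightE compile_weight].
- have budget : (INR (1346 * N) <= 2692 / eps)%R.
    rewrite mult_INR; have -> : INR 1346 = 1346%R by rewrite INR_IZR_INZ.
    have -> : (2692 / eps = 1346 * (2 / eps))%R by rewrite /Rdiv; Lra.lra.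
    by apply: Rmult_le_compat_l; Lra.lra.
  have := compile_depth
    (queries_le_mono (queries_budget n N0) (tester_queries n b c (2 * N))).
  rewrite /query_bound; elim: (compile _) => //= t T IH /andP[t0 /IH]; constructor => //.
  by apply: Rle_trans budget; apply: le_INR; apply/leP.
- move=> f fm; rewrite compile_accept; apply/RleP.
  exact: (tester_near _ b0 c0 fm (error_budget N0 fm)).
- move=> f far; rewrite compile_accept; apply/RleP.
  apply: (@tester_far _ _ _ _ _ _ eps).
    rewrite GRing.natrM -GRing.mulrA Num.Theory.ler_peMr ?Num.Theory.ler0n //.
    by rewrite -INRE; apply/RleP.
  move=> H Hm; apply/RleP; have := far _ Hm.
  by rewrite /distance -!INRE.
Qed.
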